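(* Let $S$ be a Borel space, and let $(X_n)_{n=0}^\infty$ be a measure-valued Pólya urn process in $S$ with random replacements. Then there exists a Pólya urn process $(\widetilde X_n)_{n=0}^\infty$ in $S\times[0,1]$ with deterministic replacements such that $\widetilde X_n = X_n\times\lambda$, and thus $X_n=\pi^\sharp(\widetilde X_n)$, for every $n\ge 0$. Here $\lambda$ is Lebesgue measure on $[0,1]$, $\pi:S\times[0,1]\to S$ is the projection, and $\pi^\sharp$ is the corresponding mapping of measures, $\pi^\sharp(\nu)(B)=\nu(\pi^{-1}(B))$.
   Context: A measurable space is a Borel space if it is isomorphic (as a measurable space) to a Borel subset of $[0,1]$. The interval $[0,1]$ carries its Borel $\sigma$-field and $S\times[0,1]$ the product $\sigma$-field. For a measurable space $(T,\mathcal T)$, let $\mathcal M(T)$ be the set of finite (non-negative) measures on $T$, $\mathcal M_*(T)=\{\mu\in\mathcal M(T):\mu\ne 0\}$, and $\mathcal P(T)$ the set of probability measures on $T$; each is a measurable space with the $\sigma$-field generated by the maps $\mu\mapsto\mu(B)$, $B\in\mathcal T$. A kernel from a measurable space $S_1$ to a measurable space $S_2$ is a measurable map $S_1\to\mathcal M(S_2)$; it is a probability kernel if it takes values in $\mathcal P(S_2)$. For $\mu\in\mathcal M_*(T)$ write $\mu'=\mu/\mu(T)$. Pólya urn process in $T$ with deterministic replacements: given a kernel $R=(R_s)_{s\in T}$ from $T$ to $T$ (the replacement kernel), let, for $\mu\in\mathcal M_*(T)$, $\widehat R_\mu\in\mathcal P(\mathcal M_*(T))$ be the distribution of $\mu+R_s$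 when $s$ is random with distribution $\mu'$. Then $\mu\mapsto\widehat R_\mu$ is a probability kernel from $\mathcal M_*(T)$ to itself. The urn process is the Markov chain with values in $\mathcal M_*(T)$, with a given deterministic initial state in $\mathcal M_*(T)$ and transition kernel $\widehat R$. Pólya urn process in $T$ with random replacements: given a probability kernel $s\mapsto\mathcal R_s$ from $T$ to $\mathcal M(T)$ (where $\mathcal R_s\in\mathcal P(\mathcal M(T))$ is the distribution of the random replacement measure $R_s$), let, for $\mu\in\mathcal M_*(T)$ and measurable $B\subseteq\mathcal M_*(T)$, $$\widehat R_\mu(B)=\int_T \mathcal R_s\bigl(\{\nu\in\mathcal M(T):\mu+\nu\in B\}\bigr)\,d\mu'(s).$$ Then $\mu\mapsto\widehat R_\mu$ is a probability kernel from $\mathcal M_*(T)$ to itself. The urn process is the Markov chain with values in $\mathcal M_*(T)$, with a given deterministic initial state in $\mathcal M_*(T)$ and transition kernel $\widehat R$. A Markov chain $(X_n)_{n\ge0}$ with transition kernel $\widehat R$ is one satisfying $\mathbb P(X_n\in B\mid X_0,\dots,X_{n-1})=\widehat R_{X_{n-1}}(B)$ a.s. for all $n\ge1$ and all measurable $B$. *)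

(* Defs.v *)
From HB Require Import structures.
From mathcomp Require Import all_boot all_order all_algebra.
From mathcomp Require Import all_classical all_reals all_analysis.
From mathcomp Require Import measurable_realfun giry.

Set Implicit Arguments.
Unset Strict Implicit.
Unset Printing Implicit Defensive.
Import Order.TTheory GRing.Theory Num.Theory.
Import numFieldNormedType.Exports.

Local Open Scope classical_set_scope.
Local Open Scope ring_scope.
Local Open Scope ereal_scope.

(* T is isomorphic to the Borel subset E of [0,1], via f and its inverse g;
   since E is Borel, measurability of g on E is measurability for the trace
   sigma-field. *)
Definition borel_space (R : realType) d (T : measurableType d) :=
  exists E : set R, [/\ measurable E, E `<=` `[0%R, 1%R] &
    exists f : T -> R, exists g : R -> T,
      [/\ measurable_fun [set: T] f, measurable_fun E g,
          forall t, E (f t), cancel f g & forall x, E x -> f (g x) = x]].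

Section unit_interval.
Context (R : realType).

Definition I01_set : set R := `[0%R, 1%R].

Let I01_set0 : I01_set 0%R.
Proof. by rewrite /I01_set /= in_itv /= lexx ler01. Qed.

Definition unit_itv : Type := set_type I01_set.

HB.instance Definition _ := Choice.on unit_itv.
HB.instance Definition _ :=
  isPointed.Build unit_itv (SigSub (mem_set I01_set0)).

Definition unit_itv_val (x : unit_itv) : R := \val x.

HB.instance Definition _ :=
  Measurable.copy unit_itv (g_sigma_algebra_preimageType unit_itv_val).

Lemma measurable_unit_itv_image (A : set unit_itv) :
  measurable A -> measurable (unit_itv_val @` A).
Proof.
move=> [B mB <-].
rewrite (_ : _ @` _ = B `&` I01_set).
  by apply: measurableI => //; exact: measurable_itv.
apply/seteqP; split => [_ [x [_ Bx] <-]|x [Bx Ix]].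
  by split => //; exact: set_valP.
by exists (SigSub (mem_set Ix)).
Qed.

(* the trace of Lebesgue measure on R, through the embedding of [0,1] in R *)
Definition lebesgue01 (A : set unit_itv) : \bar R :=
  lebesgue_measure (unit_itv_val @` A).

Let lebesgue01_0 : lebesgue01 set0 = 0.
Proof. by rewrite /lebesgue01 image_set0 measure0. Qed.

Let lebesgue01_ge0 A : 0 <= lebesgue01 A.
Proof. exact: measure_ge0. Qed.

Let lebesgue01_sigma_additive : semi_sigma_additive lebesgue01.
Proof.
move=> F mF tF mUF; rewrite /lebesgue01 image_bigcup.
apply: measure_semi_sigma_additive.
- by move=> n; exact: measurable_unit_itv_image.
- apply/trivIsetP => i j _ _ ij; apply/seteqP; split => // t.
  move=> [[x Fx <-] [y Fy yxE]]; have yx : y = x by exact: val_inj.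
  have /trivIsetP /(_ i j I I ij) := tF.
  by move=> /seteqP[/(_ x) + _]; apply; split => //; rewrite -yx.
- by rewrite -image_bigcup; exact: measurable_unit_itv_image.
Qed.

HB.instance Definition _ := isMeasure.Build _ _ _ lebesgue01
  lebesgue01_0 lebesgue01_ge0 lebesgue01_sigma_additive.

Let lebesgue01_setT : lebesgue01 setT = 1.
Proof.
rewrite /lebesgue01 (_ : _ @` _ = I01_set).
  by rewrite lebesgue_measure_itv /= lte_fin ltr01 oppr0 adde0.
apply/seteqP; split => [_ [x _ <-]|x Ix]; first exact: set_valP.
by exists (SigSub (mem_set Ix)).
Qed.

HB.instance Definition _ :=
  Measure_isProbability.Build _ _ _ lebesgue01 lebesgue01_setT.

End unit_interval.

(* The measurable space M(T) of finite measures on T. A measure in the library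
   also takes (meaningless) values on non-measurable sets, so that equality of
   measures is not [=] but [≡μ], equality on measurable sets. *)
Section finite_measures.
Context d (T : measurableType d) (R : realType).

Definition finite_measures : Type := {finite_measure set T -> \bar R}.

HB.instance Definition _ := gen_eqMixin finite_measures.
HB.instance Definition _ := gen_choiceMixin finite_measures.

Let mzero_fin : fin_num_fun (@mzero d T R). Proof. by []. Qed.
HB.instance Definition _ := @isFinite.Build _ _ _ (@mzero d T R) mzero_fin.
HB.instance Definition _ := isPointed.Build finite_measures mzero.

Definition finite_measures_generators : set (set finite_measures) :=
  \bigcup_(A in measurable)
    preimage_set_system setT (fun mu : finite_measures => mu A) measurable.

HB.instance Definition _ :=
  Measurable.copy finite_measures
    (g_sigma_algebraType finite_measures_generators).

Lemma measurable_fm_eval (A : set T) : measurable A ->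
  measurable_fun [set: finite_measures] (fun mu : finite_measures => mu A).
Proof.
move=> mA _ B mB; rewrite setTI; apply: sub_sigma_algebra.
by exists A => //; exists B => //; rewrite setTI.
Qed.

Lemma measurable_to_finite_measures d' (X : measurableType d')
    (f : X -> finite_measures) :
  (forall A, measurable A -> measurable_fun [set: X] (fun x => f x A)) ->
  measurable_fun [set: X] f.
Proof.
move=> mf; apply: (measurability finite_measures_generators) => //.
by move=> _ [_ [A mA [B mB <-]] <-]; rewrite setTI; exact: mf.
Qed.

(* The measurable space M_*(T) of nonzero finite measures, with the trace of
   the sigma-field of M(T). *)
Definition nonzero : set finite_measures :=
  [set mu | ~ (mu : {measure set T -> \bar R}) ≡μ mzero].

Let dirac_nonzero : nonzero (dirac point).
Proof.
move=> /(_ setT measurableT); rewrite /= /mzero diracT => /eqP.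
by rewrite onee_eq0.
Qed.

Definition nonzero_measures : Type := set_type nonzero.

HB.instance Definition _ := Choice.on nonzero_measures.
HB.instance Definition _ :=
  isPointed.Build nonzero_measures (SigSub (mem_set dirac_nonzero)).

Definition nm_val (mu : nonzero_measures) : finite_measures := \val mu.

HB.instance Definition _ :=
  Measurable.copy nonzero_measures (g_sigma_algebra_preimageType nm_val).

Lemma measurable_nm_val : measurable_fun [set: nonzero_measures] nm_val.
Proof. by move=> _ B mB; exists B. Qed.

Lemma measurable_to_nonzero_measures d' (X : measurableType d')
    (f : X -> nonzero_measures) :
  measurable_fun [set: X] (nm_val \o f) -> measurable_fun [set: X] f.
Proof.
by move=> mf _ _ [B mB <-]; rewrite !setTI; have := mf measurableT _ mB;
  rewrite setTI.
Qed.

Lemma nonzeroP (mu : finite_measures) : nonzero mu <-> 0 < mu [set: T].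
Proof.
rewrite lt0e measure_ge0 andbT; split.
  apply: contra_notN => /eqP mu0 A mA; apply/eqP.
  by rewrite -measure_le0 -mu0 le_measure// ?inE.
by move=> /eqP mu0 /(_ setT measurableT) /mu0.
Qed.

Section addition.
Variables mu nu : finite_measures.

Definition fm_add_fun : set T -> \bar R := measure_add mu nu.

HB.instance Definition _ := Measure.on fm_add_fun.

Let fm_add_fin : fin_num_fun fm_add_fun.
Proof.
move=> A mA; rewrite /fm_add_fun measure_addE fin_numD.
by rewrite !fin_num_measure.
Qed.

HB.instance Definition _ := Measure_isFinite.Build _ _ _ fm_add_fun fm_add_fin.

Definition fm_add : finite_measures := fm_add_fun.

Lemma fm_addE A : fm_add A = mu A + nu A.
Proof. exact: measure_addE. Qed.

End addition.

Let nm_add_nonzero (mu : nonzero_measures) (nu : finite_measures) :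
  nonzero (fm_add (nm_val mu) nu).
Proof.
apply/nonzeroP; rewrite fm_addE.
apply: (@lt_le_trans _ _ (nm_val mu setT)); last exact: leeDl.
by apply/nonzeroP; exact: set_valP.
Qed.

Definition nm_add (mu : nonzero_measures) (nu : finite_measures) :
  nonzero_measures := SigSub (mem_set (@nm_add_nonzero mu nu)).

End finite_measures.
Identity Coercion finite_measures_id : finite_measures >-> FiniteMeasure.type.
Coercion nm_val : nonzero_measures >-> finite_measures.

Section normalization.
Context d (T : measurableType d) (R : realType).

Lemma measurable_nm_add :
  measurable_fun [set: nonzero_measures T R * finite_measures T R]
    (fun p => nm_add p.1 p.2).
Proof.
apply: measurable_to_nonzero_measures.
apply: measurable_to_finite_measures => A mA.
rewrite (_ : (fun _ => _) =
  (fun p => nm_val p.1 A + (p.2 : finite_measures T R) A)); last first.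
  by apply/funext => p; exact: fm_addE.
apply: emeasurable_funD.
- apply: (measurableT_comp (measurable_fm_eval mA)).
  exact: (measurableT_comp (@measurable_nm_val _ T R) measurable_fst).
- exact: (measurableT_comp (measurable_fm_eval mA) measurable_snd).
Qed.

(* mu' = mu / mu(T); the default value [point] is never used here, because
   0 < mu(T) < +oo *)
Definition nm_normalize (mu : nonzero_measures T R) : probability T R :=
  mnormalize mu point.

Lemma nm_normalizeE (mu : nonzero_measures T R) (A : set T) :
  nm_normalize mu A = mu A * (fine (mu [set: T]))^-1%:E.
Proof.
rewrite /nm_normalize /= /mnormalize.
have /nonzeroP mu0 := set_valP mu.
by rewrite gt_eqF//= -leye_eq leNgt ltey_eq fin_num_measure.
Qed.

Definition nm_kernel (mu : nonzero_measures T R) :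
  {measure set T -> \bar R} := mu.

Let measurable_nm_kernel U : measurable U ->
  measurable_fun [set: nonzero_measures T R] (nm_kernel ^~ U).
Proof.
move=> mU.
exact: (measurableT_comp (measurable_fm_eval mU) (@measurable_nm_val _ T R)).
Qed.

HB.instance Definition _ := isKernel.Build _ _ _ _ _ nm_kernel
  measurable_nm_kernel.

End normalization.

Section deterministic_replacements.
Context d (T : measurableType d) (R : realType).
Variable Rk : {mfun T >-> finite_measures T R}.

Definition det_update (mu : nonzero_measures T R) (s : T) :
  nonzero_measures T R := nm_add mu (Rk s).

Let measurable_det_update2 :
  measurable_fun [set: nonzero_measures T R * T] (uncurry det_update).
Proof.
rewrite (_ : uncurry _ =
  (fun p => nm_add p.1 p.2) \o (fun p => (p.1, Rk p.2))); last first.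
  by apply/funext => -[].
apply: (measurableT_comp (@measurable_nm_add _ T R)).
apply: measurable_fun_pair => /=; first exact: measurable_fst.
exact: (measurableT_comp (@measurable_funPT _ _ _ _ Rk) measurable_snd).
Qed.

Let measurable_det_update mu : measurable_fun [set: T] (det_update mu).
Proof. exact: (measurableT_comp measurable_det_update2 (pair1_measurable mu)). Qed.

HB.instance Definition _ mu :=
  isMeasurableFun.Build _ _ _ _ (det_update mu) (measurable_det_update mu).

Definition det_urn_kernel (mu : nonzero_measures T R) :
    {measure set (nonzero_measures T R) -> \bar R} :=
  distribution (nm_normalize mu) (det_update mu).

Let measurable_det_urn_kernel U : measurable U ->
  measurable_fun [set: nonzero_measures T R] (det_urn_kernel ^~ U).
Proof.
move=> mU; pose A := uncurry det_update @^-1` U.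
have mA : measurable A.
  by rewrite -[A]setTI; exact: measurable_det_update2.
rewrite (_ : (fun _ => _) =
  (fun mu => knormalize (@nm_kernel _ T R) point mu (xsection A mu))).
  apply: (measurable_fun_xsection_finite_kernel
    (knormalize (@nm_kernel _ T R) point)).
  by rewrite inE.
apply/funext => mu.
rewrite [LHS](_ : _ = nm_normalize mu (det_update mu @^-1` U))//.
rewrite (_ : _ @^-1` _ = xsection A mu)//; apply/seteqP.
by split => s; rewrite /xsection /= inE.
Qed.

HB.instance Definition _ := isKernel.Build _ _ _ _ _ det_urn_kernel
  measurable_det_urn_kernel.

Let det_urn_kernel1 mu : det_urn_kernel mu [set: _] = 1.
Proof. exact: probability_setT. Qed.

HB.instance Definition _ := Kernel_isProbability.Build _ _ _ _ _
  det_urn_kernel det_urn_kernel1.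

End deterministic_replacements.

Section random_replacements.
Context d (T : measurableType d) (R : realType).
Variable Rk : R.-pker T ~> finite_measures T R.

Definition rand_urn_prob (mu : nonzero_measures T R)
    (B : set (nonzero_measures T R)) : \bar R :=
  \int[nm_normalize mu]_s Rk s [set nu | B (nm_add mu nu)].

Let measurable_nm_add1 (mu : nonzero_measures T R) :
  measurable_fun [set: finite_measures T R] (nm_add mu).
Proof.
exact: (measurableT_comp (@measurable_nm_add _ T R) (pair1_measurable mu)).
Qed.

Definition rand_update_prob (p : nonzero_measures T R * T)
    (B : set (nonzero_measures T R)) : \bar R :=
  Rk p.2 (nm_add p.1 @^-1` B).

Let measurable_update_preimage (mu : nonzero_measures T R) B :
  measurable B -> measurable (nm_add mu @^-1` B).
Proof.
by move=> mB; rewrite -[X in measurable X]setTI; exact: measurable_nm_add1.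
Qed.

Let update0 p : rand_update_prob p set0 = 0.
Proof. by rewrite /rand_update_prob preimage_set0 measure0. Qed.

Let update_ge0 p B : 0 <= rand_update_prob p B.
Proof. exact: measure_ge0. Qed.

Let update_sigma_additive p : semi_sigma_additive (rand_update_prob p).
Proof.
move=> F mF tF mUF; rewrite /rand_update_prob preimage_bigcup.
apply: measure_semi_sigma_additive.
- by move=> n; exact: measurable_update_preimage.
- apply/trivIsetP => i j _ _ ij; rewrite -preimage_setI.
  by move/trivIsetP : tF => /(_ _ _ I I ij) ->; rewrite preimage_set0.
- by rewrite -preimage_bigcup; exact: measurable_update_preimage.
Qed.

HB.instance Definition _ (p : nonzero_measures T R * T) :=
  isMeasure.Build _ _ _ (rand_update_prob p)
  (update0 p) (update_ge0 p) (@update_sigma_additive p).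

Definition rand_update (p : nonzero_measures T R * T) :
  {measure set (nonzero_measures T R) -> \bar R} :=
  rand_update_prob p.

Let measurable_update U : measurable U ->
  measurable_fun [set: nonzero_measures T R * T] (rand_update ^~ U).
Proof.
move=> mU; pose A := [set q : (nonzero_measures T R * T) * finite_measures T R
                     | U (nm_add q.1.1 q.2)].
have mA : measurable A.
  rewrite -[A]setTI; apply: (_ : measurable_fun setT
    (fun q : (nonzero_measures T R * T) * finite_measures T R =>
      nm_add q.1.1 q.2)) => //.
  rewrite (_ : (fun _ => _) =
    (fun p => nm_add p.1 p.2) \o (fun q => (q.1.1, q.2)))//.
  apply: (measurableT_comp (@measurable_nm_add _ T R)).
  apply: measurable_fun_pair => /=; last exact: measurable_snd.
  exact: (measurableT_comp measurable_fst measurable_fst).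
pose k (p : nonzero_measures T R * T) :
  {measure set (finite_measures T R) -> \bar R} := Rk p.2.
have mk V : measurable V -> measurable_fun setT (k ^~ V).
  move=> mV.
  exact: (measurableT_comp (measurable_kernel Rk V mV) measurable_snd).
have k1 p : k p setT = 1 by exact: prob_kernel.
pose K := isKernel.Build _ _ _ _ _ k mk.
pose kk : R.-ker _ ~> _ := HB.pack k K.
pose kp : R.-pker _ ~> _ := HB.pack k K (Kernel_isProbability.Build _ _ _ _ _ kk k1).
rewrite (_ : (fun _ => _) = (fun p => kp p (xsection A p))).
  by apply: measurable_fun_xsection_finite_kernel; rewrite inE.
apply/funext => p.
rewrite [LHS](_ : _ = Rk p.2 (nm_add p.1 @^-1` U))//.
rewrite (_ : _ @^-1` _ = xsection A p)//; apply/seteqP.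
by split => nu; rewrite /xsection /= inE.
Qed.

HB.instance Definition _ := isKernel.Build _ _ _ _ _ rand_update
  measurable_update.

Let rand_update1 p : rand_update p setT = 1.
Proof. exact: prob_kernel. Qed.

HB.instance Definition _ := Kernel_isProbability.Build _ _ _ _ _
  rand_update rand_update1.

(* the same measure as a composite of kernels, from which its properties follow *)
Definition rand_urn_composite : nonzero_measures T R ->
    {measure set (nonzero_measures T R) -> \bar R} :=
  mkcomp (knormalize (@nm_kernel _ T R) point) rand_update.

HB.instance Definition _ (mu : nonzero_measures T R) := isMeasure.Build _ _ _ (rand_urn_prob mu)
  (measure0 (rand_urn_composite mu)) (measure_ge0 (rand_urn_composite mu))
  (@measure_semi_sigma_additive _ _ _ (rand_urn_composite mu)).

Definition rand_urn_kernel (mu : nonzero_measures T R) :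
  {measure set (nonzero_measures T R) -> \bar R} := rand_urn_prob mu.

Let measurable_rand_urn_kernel U : measurable U ->
  measurable_fun [set: nonzero_measures T R] (rand_urn_kernel ^~ U).
Proof.
exact: (@measurable_fun_mkcomp_sfinite _ _ _ _ _ _ _
  (knormalize (@nm_kernel _ T R) point) rand_update).
Qed.

HB.instance Definition _ := isKernel.Build _ _ _ _ _ rand_urn_kernel
  measurable_rand_urn_kernel.

Let rand_urn_kernel1 mu : rand_urn_kernel mu [set: _] = 1.
Proof.
rewrite /rand_urn_kernel /= /rand_urn_prob.
under eq_integral do rewrite prob_kernel.
by rewrite integral_cst// mul1e; exact: (probability_setT (nm_normalize mu)).
Qed.

HB.instance Definition _ := Kernel_isProbability.Build _ _ _ _ _
  rand_urn_kernel rand_urn_kernel1.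

End random_replacements.

Section markov_chain.
Context d (Omega : measurableType d) (R : realType) (P : probability Omega R).

(* Y is a version of P(A | G) *)
Definition is_cond_prob (G : set_system Omega) (A : set Omega)
    (Y : Omega -> \bar R) :=
  [/\ P.-integrable [set: Omega] Y,
      forall B, measurable B -> G (Y @^-1` B) &
      forall D, G D -> \int[P]_(w in D) Y w = P (A `&` D)].

Definition markov_chain d' (E : measurableType d') (K : R.-pker E ~> E)
    (X : nat -> {RV P >-> E}) :=
  forall (n : nat) (B : set E), measurable B ->
    exists2 Y : Omega -> \bar R,
      is_cond_prob (g_sigma_preimage (fun i : 'I_n.+1 => X i : Omega -> E))
        (X n.+1 @^-1` B) Y &
      {ae P, forall w, Y w = K (X n w) B}.

Context d' (T : measurableType d').
Implicit Types X : nat -> {RV P >-> nonzero_measures T R}.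

Definition deterministic_start X :=
  exists mu0 : nonzero_measures T R, forall w, nm_val (X 0%N w) ≡μ nm_val mu0.

Definition polya_urn_deterministic X :=
  deterministic_start X /\
  exists Rk : {mfun T >-> finite_measures T R},
    markov_chain (det_urn_kernel Rk) X.

Definition polya_urn_random X :=
  deterministic_start X /\
  exists Rk : R.-pker T ~> finite_measures T R,
    markov_chain (rand_urn_kernel Rk) X.

End markov_chain.

(* Main.v *)
Require Import Defs.
From HB Require Import structures.
From mathcomp Require Import all_boot all_order all_algebra.
From mathcomp Require Import all_classical all_reals all_analysis.
From mathcomp Require Import measurable_realfun giry.
From mathcomp Require Import ring lra.
Import Order.TTheory GRing.Theory Num.Theory.
Import numFieldNormedType.Exports.
Local Open Scope classical_set_scope.
Local Open Scope ring_scope.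
Local Open Scope ereal_scope.
Set Implicit Arguments.
Unset Strict Implicit.
Unset Printing Implicit Defensive.

(** Why the theorem holds.  A replacement drawn at random from [K s] can be
written [F (s, u)] for a fixed measurable [F] and an independent uniform [u]
in [[0,1]].  Give every colour [s] an extra coordinate [u]: sampling from the
normalization of [mu \x lambda] samples [s] from [mu'] and, independently, a
uniform [u].  So the deterministic replacement [F (s, u) \x lambda] in the
urn [mu \x lambda] leads to [(mu + F (s, u)) \x lambda], and the added
measure [F (s, u)] has the law prescribed by [K s].  Thus
[mu |-> mu \x lambda] carries the random urn to the deterministic one
([det_urn_kernel_prod]), and it carries Markov chains to Markov chains because
it loses no information: [mu] is the first marginal of [mu \x lambda]
([markov_chain_image]).

The analytic content is the existence of [F] ([kernel_randomization]).  For a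
kernel into [[0,1]] one takes the quantile function of [K s]: it turns
Lebesgue measure into [K s] ([quantile_law]) and is jointly measurable
([measurable_quantile]).  Here the kernel takes its values in the space of
finite measures on [S], which is therefore coded by a real number
([finite_measures_retract]).  Transported to [[0,1]], a measure is determined
by its masses on the rays ending at rational points, hence by one sequence of
extended reals; comparing the terms of the sequence with all rationals gives a
sequence of bits, and a series in base 3 stores the bits in one real
([encode_seqK]).  To decode, the measure is rebuilt as the image of Lebesgue
measure on a segment under the quantile function of the decoded masses, mapped
back to [S].  This recipe yields a finite measure for every real number, even
one that codes no measure, so the range of the coding never has to be
described.

A measure is a function on all sets, while only its values on measurable sets
matter; so decoding and taking a marginal are inverse to coding and to
[_ \x lambda] only up to [≡μ].  This suffices, since a measurable set of
measures cannot separate two measures that agree on measurable sets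
([measurable_finite_measures_sat]). *)

(** * Coding a sequence of extended reals by one real number *)

Section ternary_coding.
Context {R : realType}.
Local Open Scope ring_scope.

Definition bit_term (b : nat -> bool) : R ^nat :=
  fun j => (b j)%:R * 3^-1 ^+ j.+1.

(** Base 3, and not base 2, leaves a gap: a first bit 0 gives at most [2^-1 / 3],
a first bit 1 at least [1 / 3], so the bits can be read off by comparisons and
no real number has two expansions. *)
Definition code (b : nat -> bool) : R := limn (series (bit_term b)).

Lemma bit_term_ge0 b j : 0 <= bit_term b j.
Proof. by rewrite mulr_ge0 ?exprn_ge0 ?invr_ge0. Qed.

Let third_lt1 : `|3^-1 : R| < 1.
Proof. by rewrite ger0_norm ?invr_ge0// invf_lt1 // ltr1n. Qed.

Lemma bit_term_le b j : bit_term b j <= geometric (3^-1 : R) 3^-1 j.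
Proof.
rewrite /bit_term /= exprS.
by case: (b j); rewrite ?mul1r ?mul0r // mulr_ge0 ?exprn_ge0 ?invr_ge0.
Qed.

Lemma cvg_code b : cvgn (series (bit_term b)).
Proof.
apply: (@series_le_cvg _ _ (geometric (3^-1 : R) 3^-1)).
- exact: bit_term_ge0.
- by move=> j; apply: geometric_ge0; rewrite invr_ge0.
- exact: bit_term_le.
- exact: is_cvg_geometric_series.
Qed.

Lemma code_ge0 b : 0 <= code b.
Proof.
apply: limr_ge; first exact: cvg_code.
by near=> n; rewrite /series /= sumr_ge0// => i _; exact: bit_term_ge0.
Unshelve. all: end_near. Qed.

Lemma code_le_half b : code b <= 2^-1.
Proof.
apply: (@le_trans _ _ (limn (series (geometric (3^-1 : R) 3^-1)))).
  apply: ler_lim; first exact: cvg_code.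
    exact: is_cvg_geometric_series.
  near=> n; rewrite /series /= ler_sum// => i _; exact: bit_term_le.
rewrite (cvg_lim _ (cvg_geometric_series third_lt1))//.
by rewrite le_eqVlt; apply/orP; left; apply/eqP; field.
Unshelve. all: end_near. Qed.

Lemma codeS b : code b = 3^-1 * ((b 0%N)%:R + code (b \o S)).
Proof.
have h : series (bit_term b) @ \oo --> 3^-1 * ((b 0%N)%:R + code (b \o S)).
  rewrite -(cvg_shiftS (series (bit_term b))).
  rewrite [X in X @ _ --> _](_ : _ =
    (fun n => 3^-1 * ((b 0%N)%:R + series (bit_term (b \o S)) n))).
    apply: cvgMr; apply: cvgD; first exact: cvg_cst.
    exact: cvg_code.
  apply/funext => n; rewrite /series /= big_nat_recl//= mulrDr; congr (_ + _).
    by rewrite /bit_term expr1 mulrC.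
  by rewrite mulr_sumr; apply: eq_bigr => i _; rewrite /bit_term /= exprS; ring.
exact: cvg_lim h.
Qed.

Definition ternary_shift (x : R) : R := 3 * x - (1 <= 3 * x)%R%:R.

Definition ternary_bit (j : nat) (x : R) : bool := 1 <= 3 * iter j ternary_shift x.

Lemma ternary_bit0_code b : (1 <= 3 * code b) = b 0%N.
Proof.
have := code_ge0 (b \o S); have := code_le_half (b \o S).
rewrite (codeS b); case: (b 0%N) => /= ? ?.
  by apply/idP; lra.
by apply/negbTE; rewrite -ltNge; lra.
Qed.

Lemma ternary_shift_code b : ternary_shift (code b) = code (b \o S).
Proof. by rewrite /ternary_shift ternary_bit0_code codeS; lra. Qed.

Lemma ternary_bit_code b j : ternary_bit j (code b) = b j.
Proof.
rewrite /ternary_bit; elim: j b => [|j IH] b; first exact: ternary_bit0_code.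
by rewrite iterSr ternary_shift_code IH.
Qed.

Lemma measurable_ternary_bit j : measurable_fun setT (ternary_bit j).
Proof.
have m3 : measurable_fun setT (fun x : R => 1 <= 3 * x).
  by apply: measurable_fun_ler => //; exact: measurable_funM.
have msh : measurable_fun setT ternary_shift.
  apply: measurable_funB; first exact: measurable_funM.
  exact: (@measurableT_comp _ _ _ _ _ _ (fun c : bool => c%:R : R)).
apply: (measurableT_comp m3).
elim: j => [|j IH]; first exact: measurable_id.
rewrite [X in measurable_fun _ X](_ : _ = ternary_shift \o iter j ternary_shift) //.
exact: measurableT_comp.
Qed.

Lemma measurable_code d (T : measurableType d) (b : T -> nat -> bool) :
  (forall j, measurable_fun setT (b ^~ j)) ->
  measurable_fun setT (fun t => code (b t)).
Proof.
move=> mb; apply: (@measurable_fun_cvg _ _ _ _ (fun n t => series (bit_term (b t)) n)).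
- move=> n; rewrite /series /=; apply: measurable_sum => j.
  rewrite /bit_term; apply: measurable_funM => //.
  exact: (@measurableT_comp _ _ _ _ _ _ (fun c : bool => c%:R : R)).
- by move=> t _; exact: cvg_code.
Qed.

End ternary_coding.

Section sequence_coding.
Context {R : realType}.

(** An extended real is the supremum of the rationals below it, so the answers
to all the questions [q < x] determine it. *)
Lemma lee_ratP (x y : \bar R) :
  (forall q : rat, (ratr q)%:E < x -> (ratr q)%:E <= y) -> x <= y.
Proof.
move=> H; rewrite leNgt; apply/negP => yx.
have [a [b [ab ya bx]]] : exists a b : R, [/\ (a < b)%R, y <= a%:E & b%:E <= x].
  move: x y yx {H} => [x| |] [y| |]//.
  - by rewrite lte_fin => yx; exists y, x.
  - by exists (x - 1)%R, x; split; rewrite ?leNye//; lra.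
  - by exists y, (y + 1)%R; split; rewrite ?leey//; lra.
  - by exists 0%R, 1%R; split; rewrite ?leey ?leNye.
have [q /[!in_itv]/= /andP[aq qb]] := rat_in_itvoo ab.
have := H q (lt_le_trans _ bx); rewrite lte_fin => /(_ qb).
by apply/negP; rewrite -ltNge (le_lt_trans ya)// lte_fin.
Qed.

(** Bit [pickle (n, q)] answers the question whether [q < c n]. *)
Definition level_bit (c : nat -> \bar R) (j : nat) : bool :=
  if unpickle j is Some (n, q) then (ratr (q : rat))%:E < c n else false.

Definition level (n j : nat) (x : R) : \bar R :=
  if unpickle j is Some (i, q) then
    if (i == n) && ternary_bit j x then (ratr (q : rat))%:E else -oo
  else -oo.

Definition encode_seq (c : nat -> \bar R) : R := code (level_bit c).

(** [level n j x] ranges over the rationals certified by [x] to lie below the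
[n]-th term, with [-oo] standing for no information. *)
Definition decode_seq (n : nat) (x : R) : \bar R := esups (level n ^~ x) 0%N.

Lemma encode_seq_itv c : (0 <= encode_seq c <= 1)%R.
Proof.
by rewrite /encode_seq code_ge0/= (le_trans (code_le_half _))// invf_le1// ler1n.
Qed.

Lemma measurable_encode_seq d (T : measurableType d) (c : T -> nat -> \bar R) :
  (forall n, measurable_fun setT (c ^~ n)) ->
  measurable_fun setT (fun t => encode_seq (c t)).
Proof.
move=> mc; apply: measurable_code => j; rewrite /level_bit.
case: unpickle => [[n q]|]; last exact: measurable_cst.
by apply: measurable_fun_lte => //; exact: measurable_cst.
Qed.

Lemma measurable_decode_seq n : measurable_fun setT (decode_seq n).
Proof.
apply: measurable_fun_esups => j; rewrite /level.
case: unpickle => [[i q]|]; last exact: measurable_cst.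
apply: measurable_fun_ifT => //; apply: measurable_and => //.
exact: measurable_ternary_bit.
Qed.

Lemma encode_seqK c n : decode_seq n (encode_seq c) = c n.
Proof.
rewrite /decode_seq /esups; apply/eqP; rewrite eq_le; apply/andP; split.
  apply: ub_ereal_sup => _ [j _ <-]; rewrite /level /encode_seq ternary_bit_code.
  rewrite /level_bit; case: unpickle => [[i q]|]; last exact: leNye.
  have [->|_] /= := eqVneq i n; last exact: leNye.
  by case: ifPn => [/ltW//|_]; exact: leNye.
apply/lee_ratP => q qc.
apply: ereal_sup_ubound; exists (pickle (n, q)) => //.
by rewrite /level /encode_seq ternary_bit_code /level_bit pickleK eqxx qc.
Qed.

End sequence_coding.
(** * Finite measures as images of Lebesgue measure *)

Section image_measures.
Context {R : realType}.

Section finite_measure_of.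
Context d (T : measurableType d).
Variable mu : {measure set T -> \bar R}.

(** The finiteness proof is an argument so that unification can recover it
when it looks for the finite measure structure. *)
Definition fm_of_fun (mu_fin : fin_num_fun mu) : set T -> \bar R := mu.

HB.instance Definition _ mu_fin := Measure.on (fm_of_fun mu_fin).
HB.instance Definition _ mu_fin :=
  Measure_isFinite.Build _ _ _ (fm_of_fun mu_fin) mu_fin.

Definition fm_of (mu_fin : fin_num_fun mu) : finite_measures T R :=
  fm_of_fun mu_fin.

End finite_measure_of.

Section image.
Context d1 d2 (T1 : measurableType d1) (T2 : measurableType d2).
Variables (mu : finite_measures T1 R) (f : {mfun T1 >-> T2}).

Definition fm_image_fun : set T2 -> \bar R := pushforward mu f.

Let fm_image0 : fm_image_fun set0 = 0.
Proof. by rewrite /fm_image_fun /pushforward preimage_set0 measure0. Qed.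

Let fm_image_ge0 A : 0 <= fm_image_fun A.
Proof. exact: measure_ge0. Qed.

Let fm_image_sigma_additive : semi_sigma_additive fm_image_fun.
Proof.
have mf : measurable_fun setT f by [].
exact: (@measure_semi_sigma_additive _ _ _
  (measure_function_pushforward__canonical__measure_function_Measure mu mf)).
Qed.

HB.instance Definition _ := isMeasure.Build _ _ _ fm_image_fun
  fm_image0 fm_image_ge0 fm_image_sigma_additive.

Let fm_image_fin : fin_num_fun fm_image_fun.
Proof.
move=> A mA; rewrite fin_num_measure// -[X in measurable X]setTI.
exact: measurable_funPT.
Qed.

HB.instance Definition _ := Measure_isFinite.Build _ _ _ fm_image_fun fm_image_fin.

Definition fm_image : finite_measures T2 R := fm_image_fun.

Lemma fm_imageE A : fm_image A = mu (f @^-1` A).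
Proof. by []. Qed.

End image.

Section lebesgue_segment.
Variable m : R.

Definition segment_lebesgue_fun (A : set R) : \bar R :=
  lebesgue_measure (A `&` `[0%R, m]).

Let segment_lebesgue0 : segment_lebesgue_fun set0 = 0.
Proof. by rewrite /segment_lebesgue_fun set0I measure0. Qed.

Let segment_lebesgue_ge0 A : 0 <= segment_lebesgue_fun A.
Proof. exact: measure_ge0. Qed.

Let segment_lebesgue_sigma_additive : semi_sigma_additive segment_lebesgue_fun.
Proof.
move=> F mF tF mUF; rewrite /segment_lebesgue_fun setI_bigcupl.
apply: measure_semi_sigma_additive.
- by move=> n; apply: measurableI; [exact: mF|exact: measurable_itv].
- exact: (trivIset_setIr (G := fun=> _) tF).
- by rewrite -setI_bigcupl; apply: measurableI => //; exact: measurable_itv.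
Qed.

HB.instance Definition _ := isMeasure.Build _ _ _ segment_lebesgue_fun
  segment_lebesgue0 segment_lebesgue_ge0 segment_lebesgue_sigma_additive.

Let segment_lebesgue_fin : fin_num_fun segment_lebesgue_fun.
Proof.
move=> A mA; rewrite ge0_fin_numE//.
apply: (@le_lt_trans _ _ (lebesgue_measure `[0%R, m]%classic)).
  rewrite /segment_lebesgue_fun le_measure ?inE//.
  by apply: measurableI => //; exact: measurable_itv.
by rewrite lebesgue_measure_itv/=; case: ifP => // _; rewrite -EFinB ltey.
Qed.

HB.instance Definition _ :=
  Measure_isFinite.Build _ _ _ segment_lebesgue_fun segment_lebesgue_fin.

Definition segment_lebesgue : finite_measures R R := segment_lebesgue_fun.

Lemma segment_lebesgueE A :
  segment_lebesgue A = lebesgue_measure (A `&` `[0%R, m]).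
Proof. by []. Qed.

End lebesgue_segment.

End image_measures.
(** * Quantile functions *)

Section quantile.
Context {R : realType}.

(** Rational points clipped to [[0,1]], which makes every infimum below range
over a set bounded from below. *)
Definition grid (n : nat) : R :=
  if unpickle n is Some q then Num.max 0%R (Num.min 1%R (ratr (q : rat))) else 0%R.

Lemma grid_ge0 n : (0 <= grid n)%R.
Proof. by rewrite /grid; case: unpickle => // q; rewrite le_max lexx. Qed.

Lemma grid_one : grid (pickle (1%R : rat)) = 1%R.
Proof. by rewrite /grid pickleK rmorph1 minxx; apply/max_idPr. Qed.

Lemma grid_dense (x y : R) : (0 < y)%R -> (y <= 1)%R -> (x < y)%R ->
  exists n, (x < grid n < y)%R.
Proof.
move=> y0 y1 xy; have xy' : (Num.max x 0 < y)%R by rewrite gt_max xy y0.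
have [q /[!in_itv]/= /andP[]] := rat_in_itvoo xy'.
rewrite gt_max => /andP[xq q0] qy; exists (pickle q).
rewrite /grid pickleK (min_idPr _) ?(le_trans (ltW qy))// (max_idPr _) ?xq ?qy//.
exact: ltW.
Qed.

(** When [c n] is the mass of the ray that ends at [grid n], this is the usual
quantile function.  It is defined for any [c], because it will be applied to
decoded sequences; the point [1] keeps the set nonempty. *)
Definition quantile (c : nat -> \bar R) (t : R) : R :=
  inf ([set 1%R] `|` [set grid n | n in [set n | t%:E < c n]]).

Lemma quantile_ltP c t y : (quantile c t < y)%R <->
  (1 < y)%R \/ exists n, (grid n < y)%R /\ t%:E < c n.
Proof.
rewrite /quantile; set A := (X in inf X).
have A0 : A !=set0 by exists 1%R; left.
have lbA : has_lbound A.
  by exists 0%R => _ [->|[n _ <-]] //; exact: grid_ge0.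
split => [Qy|].
  have [|_ [->|[n tc <-]]] := @inf_adherent _ A (y - inf A) _ (conj A0 lbA).
  - by rewrite subr_gt0.
  - by rewrite addrC subrK; left.
  - by rewrite addrC subrK => ny; right; exists n.
move=> [y1|[n [ny tc]]]; apply: le_lt_trans; [|exact: y1| |exact: ny].
  by apply: ge_inf => //; left.
by apply: ge_inf => //; right; exists n.
Qed.

(** The condition [quantile c t < y] is a countable disjunction of comparisons
between [t] and terms of [c]; hence joint measurability. *)
Lemma measurable_quantile d (X : measurableType d) (c : X -> nat -> \bar R) (t : X -> R) :
  (forall n, measurable_fun setT (c ^~ n)) -> measurable_fun setT t ->
  measurable_fun setT (fun x => quantile (c x) (t x)).
Proof.
move=> mc mt; apply: (measurability _ (RGenInftyO.measurableE R)) => // _ [_ [y ->] <-].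
rewrite setTI (_ : _ @^-1` _ = [set x | (1 < y)%R] `|`
    \bigcup_(n in [set n | (grid n < y)%R]) [set x | (t x)%:E < c x n]).
  apply: measurableU.
    case: (ltP 1%R y) => _; first by rewrite (_ : [set _ | _] = setT)//; apply/seteqP.
    by rewrite (_ : [set _ | _] = set0)//; apply/seteqP; split.
  apply: bigcup_measurable => n _; rewrite -[X in measurable X]setTI.
  by apply: measurable_lte => //; exact/measurable_EFinP.
apply/seteqP; split => x /=; rewrite in_itv/=.
  by move=> /quantile_ltP[|[n [ny tc]]]; [left|right; exists n].
by move=> h; apply/quantile_ltP; case: h => [|[n ny tc]]; [left|right; exists n].
Qed.

(** On the segment of length [nu setT] the event [quantile c t < y] is, for [y]
in []0,1]], the interval of the [t] below [nu ]-oo, y[], whose length is that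
mass.  So the image of Lebesgue measure agrees with [nu] on open left rays,
which form a pi-system generating the Borel sets. *)
Lemma quantile_law (nu : {finite_measure set R -> \bar R}) :
  nu (~` `[0%R, 1%R]) = 0 ->
  forall B, measurable B ->
  lebesgue_measure ([set t | (0 <= t <= fine (nu setT))%R /\
    B (quantile (fun n => nu `]-oo, grid n]%classic) t)]) = nu B.
Proof.
move=> nu01; set Q := quantile _; set m := fine _.
have mQ : measurable_fun setT Q by apply: measurable_quantile => //; exact: measurable_id.
pose H : {mfun R >-> R} := HB.pack Q (isMeasurableFun.Build _ _ _ _ Q mQ).
pose law := fm_image (segment_lebesgue m) H.
have lawE A : law A = lebesgue_measure ([set t | (0 <= t <= m)%R /\ A (Q t)]).
  rewrite [LHS](_ : _ = lebesgue_measure (Q @^-1` A `&` `[0%R, m])) //.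
  by congr (lebesgue_measure _); apply/seteqP; split => t /=; rewrite in_itv/= => -[].
have nu_small (A : set R) : measurable A -> A `<=` ~` `[0%R, 1%R] -> nu A = 0.
  move=> mA Asub; apply/eqP; rewrite -measure_le0 -nu01 le_measure// inE//.
  exact: measurableC.
have m0 : (0 <= m)%R by exact: fine_ge0.
have law_ray y : law `]-oo, y[%classic = nu `]-oo, y[%classic.
  rewrite lawE; have [y1|y1] := ltP 1%R y.
    rewrite (_ : [set t | _] = `[0%R, m]%classic); last first.
      apply/seteqP; split => t /=; rewrite in_itv/=; first by case.
      by move=> tm; split => //; rewrite in_itv/=; apply/quantile_ltP; left.
    have -> : nu `]-oo, y[%classic = nu setT.
      rewrite -(setvU `]-oo, y[%classic) measureU//.
      - rewrite [X in _ = X + _]nu_small ?add0e//; first exact: measurableC.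
        by apply: subsetC => t /=; rewrite !in_itv/= => /andP[_ /le_lt_trans]; apply.
      - exact: measurableC.
      - exact: setICl.
    rewrite lebesgue_measure_itv/= lte_fin -[RHS]fineK ?fin_num_measure// -/m.
    by case: ltgtP m0 => // [m0|<-] _; rewrite ?sube0.
  have nu_grid n : (grid n < y)%R -> nu `]-oo, grid n]%classic <= nu `]-oo, y[%classic.
    move=> ny; rewrite le_measure ?inE//.
    by move=> t /=; rewrite !in_itv/= => /le_lt_trans; apply.
  have [y0|y0] := leP y 0%R.
    rewrite nu_small//; last first.
      move=> t /=; rewrite !in_itv/= => ty; apply/negP.
      by rewrite (lt_geF (lt_le_trans ty y0)).
    rewrite (_ : [set t | _] = set0) ?measure0//; apply/seteqP; split => t //=.
    rewrite in_itv/= => -[_ /quantile_ltP[|[n []]]]; first by rewrite ltNge y1.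
    by rewrite ltNge (le_trans y0 (grid_ge0 n)).
  have nuyE : nu `]-oo, y[%classic = (fine (nu `]-oo, y[%classic))%:E.
    by rewrite fineK ?fin_num_measure.
  set F := fine (nu `]-oo, y[%classic) in nuyE *.
  have Fm : (F <= m)%R by rewrite fine_le ?fin_num_measure// le_measure ?inE.
  have F0 : (0 <= F)%R by exact: fine_ge0.
  (* continuity from below, and density of the grid *)
  have nu_approx t : t%:E < nu `]-oo, y[%classic ->
      exists n, (grid n < y)%R /\ t%:E < nu `]-oo, grid n]%classic.
    pose r k : set R := `]-oo, (y - k.+1%:R^-1)%R]%classic.
    have rE : \bigcup_k r k = `]-oo, y[%classic.
      apply/seteqP; split => [z [k _]|z]; rewrite /r /= !in_itv/=.
        by move=> /le_lt_trans; apply; rewrite ltrBlDr ltrDl invr_gt0.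
      by move=> /ltr_add_invr[k kz]; exists k => //=; rewrite in_itv/= lerBrDr ltW.
    have nur : nu (r k) @[k --> \oo] --> nu `]-oo, y[%classic.
      rewrite -rE; apply: nondecreasing_cvg_mu => //.
      - by move=> k; exact: measurable_itv.
      - by rewrite rE.
      - move=> k l kl; apply/subsetPset => z; rewrite /r /= !in_itv/= => /le_trans; apply.
        by rewrite lerD2l lerN2 lef_pV2 ?posrE// ler_nat ltnS.
    move=> tlt; have [k tk] : exists k, t%:E < nu (r k).
      apply: contrapT => /forallNP small; move: tlt; rewrite ltNge => /negP; apply.
      rewrite -(cvg_lim _ nur)//; apply: lime_le.
        by apply/cvg_ex; eexists; exact: nur.
      by near=> k; rewrite leNgt; apply/negP/small.
    have [y1' | y1'] := ltP (y - k.+1%:R^-1)%R y; last first.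
      by move: y1'; rewrite lerBrDr gerDl leNgt invr_gt0 ltr0n.
    have [n /andP[rn ny]] := grid_dense y0 y1 y1'.
    exists n; split => //; apply: (lt_le_trans tk); rewrite le_measure ?inE//.
      exact: measurable_itv.
    by move=> z; rewrite /r /= !in_itv/= => /le_trans; apply; exact: ltW.
  rewrite (_ : [set t | _] = `[0%R, F[%classic); last first.
    apply/seteqP; split => t /=; rewrite !in_itv/=.
      move=> [/andP[-> _] /quantile_ltP[|[n [ny tn]]]]; first by rewrite ltNge y1.
      by rewrite -lte_fin -nuyE (lt_le_trans tn)// nu_grid.
    move=> /andP[t0 tF]; split; first by rewrite t0 (le_trans (ltW tF)).
    by apply/quantile_ltP; right; apply: nu_approx; rewrite nuyE lte_fin.
  rewrite lebesgue_measure_itv/= lte_fin nuyE.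
  by case: ltgtP F0 => // [F0|<-] _; rewrite ?sube0.
move=> B mB; rewrite -lawE.
apply: (@measure_unique _ R _ (@RGenInftyO.G R)
  (fun k => `]-oo, k%:R[%classic) _ _ _ _ law nu) => //.
- exact: RGenInftyO.measurableE.
- move=> _ _ [x ->] [y ->]; exists (Num.min x y).
  by apply/seteqP; split => z /=; rewrite !in_itv/= lt_min => /andP.
- by move=> k; eexists; reflexivity.
- apply/seteqP; split => // z _; exists (Num.bound `|z|) => //=.
  by rewrite in_itv/= (le_lt_trans (ler_norm _))// archi_boundP.
- by move=> _ [y ->]; exact: law_ray.
- by move=> k; rewrite ltey_eq fin_num_measure.
Unshelve. all: end_near. Qed.
End quantile.
(** * Coding the finite measures on a Borel space *)

Lemma measurable_preimageT d1 d2 (T1 : measurableType d1) (T2 : measurableType d2)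
    (f : T1 -> T2) (B : set T2) :
  measurable_fun setT f -> measurable B -> measurable (f @^-1` B).
Proof. by move=> mf mB; rewrite -[X in measurable X]setTI; exact: mf. Qed.

Section borel_measures.
Context {R : realType} d (S : measurableType d).

Definition extend_point (E : set R) (g : R -> S) (x : R) : S :=
  if x \in E then g x else point.

Lemma measurable_extend_point (E : set R) (g : R -> S) :
  measurable E -> measurable_fun E g -> measurable_fun setT (extend_point E g).
Proof.
move=> mE mg.
have memE : E = mem E @^-1` [set true].
  by apply/seteqP; split => x /=; [move=> /mem_set|move=> /set_mem].
apply: measurable_fun_if => //.
- by apply: (measurable_fun_bool true); rewrite setTI -memE.
- by rewrite setTI -memE.
Qed.

(** Let [f] and [g] be the inverse maps given by [borel_space].  The code of
[mu] encodes the masses under [mu] of the sets [f <= grid n].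
The decoder pushes Lebesgue measure on a segment through the quantile function
of the decoded masses and then through [g].  On the code of [mu] the quantile
function produces the image of [mu] by [f], and [g] undoes [f]; on any other
real it produces some finite measure. *)
Lemma finite_measures_retract : borel_space R S ->
  exists (e : finite_measures S R -> R) (D : R -> finite_measures S R),
    [/\ measurable_fun setT e, measurable_fun setT D,
        forall mu, (0 <= e mu <= 1)%R & forall mu, D (e mu) ≡μ mu].
Proof.
move=> [E [mE E01 [f [g [mf mg Ef gf _]]]]].
have mg' := measurable_extend_point mE mg; set g' := extend_point E g in mg'.
have g'f s : g' (f s) = s by rewrite /g' /extend_point mem_set.
pose fF : {mfun S >-> R} := HB.pack f (isMeasurableFun.Build _ _ _ _ f mf).
pose c (mu : finite_measures S R) n := fm_image mu fF `]-oo, grid n]%classic.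
pose H x t := g' (quantile (decode_seq ^~ x) t).
have mH2 : measurable_fun setT (fun p : R * R => H p.1 p.2).
  apply: (measurableT_comp mg'); apply: measurable_quantile => // n.
  exact: (measurableT_comp (measurable_decode_seq n)).
have mH x : measurable_fun setT (H x).
  exact: (measurableT_comp mH2 (pair1_measurable x)).
pose HF x : {mfun R >-> S} := HB.pack (H x) (isMeasurableFun.Build _ _ _ _ _ (mH x)).
(* the mass of the ray up to 1 is the total mass; taking its real part bounds
   the segment even when the decoded value is infinite *)
pose mass x : R := fine (decode_seq (pickle (1%R : rat)) x).
have mmass : measurable_fun setT mass.
  by apply: measurableT_comp => //; exact: measurable_decode_seq.
exists (fun mu => encode_seq (c mu)),
  (fun x => fm_image (segment_lebesgue (mass x)) (HF x)).
split.
- apply: measurable_encode_seq => n; apply: measurable_fm_eval.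
  exact: measurable_preimageT.
- apply: measurable_to_finite_measures => A mA.
  (* the decoded mass of A is the length of a section of a measurable set *)
  pose W := [set p : R * R | A (H p.1 p.2) /\ (0 <= p.2 <= mass p.1)%R].
  have mW : measurable W.
    rewrite (_ : W = (fun p => H p.1 p.2) @^-1` A `&`
        ([set p | 0 <= (p.2)%:E] `&` [set p | (p.2)%:E <= (mass p.1)%:E])).
      apply: measurableI; first exact: (measurable_preimageT mH2).
      apply: measurableI; rewrite -[X in measurable X]setTI; apply: measurable_lee => //;
        apply/measurable_EFinP => //; exact: (measurableT_comp mmass).
    by apply/seteqP; split => p /=; rewrite !lee_fin;
      [move=> [? /andP[]]|move=> [? [? ?]]; split => //; apply/andP].
  rewrite (_ : (fun _ => _) = (fun x => lebesgue_measure (xsection W x))).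
    exact: (@measurable_fun_xsection _ _ _ _ _ (@lebesgue_measure R)).
  apply/funext => x; rewrite fm_imageE segment_lebesgueE; congr lebesgue_measure.
  by apply/seteqP; split => t; rewrite /xsection/= inE /W/= in_itv/=.
- by move=> mu; exact: encode_seq_itv.
- move=> mu A mA.
  have decE : decode_seq ^~ (encode_seq (c mu)) = c mu.
    by apply/funext => n; rewrite encode_seqK.
  have nu01 : fm_image mu fF (~` `[0%R, 1%R]) = 0.
    rewrite fm_imageE (_ : _ @^-1` _ = set0) ?measure0//; apply/seteqP; split => // s.
    by apply; exact: E01.
  have massE : mass (encode_seq (c mu)) = fine (fm_image mu fF setT).
    rewrite /mass encode_seqK /c grid_one; congr fine; rewrite !fm_imageE; congr (mu _).
    apply/seteqP; split => // s _ /=; rewrite in_itv/=.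
    by have /E01 := Ef s; rewrite /= in_itv/= => /andP[].
  have mgA : measurable (g' @^-1` A) by exact: measurable_preimageT.
  have := quantile_law nu01 mgA.
  rewrite [X in _ = X -> _]fm_imageE (_ : fF @^-1` (g' @^-1` A) = A); last first.
    by apply/funext => s; rewrite -[LHS]/(A (g' (f s))) g'f.
  move=> nuE; rewrite [LHS]fm_imageE segment_lebesgueE massE.
  apply: etrans nuE; congr lebesgue_measure.
  apply/seteqP; split => t /=; rewrite in_itv/= /H decE; by case.
Qed.

End borel_measures.
(** * Invariance of measurable sets of measures under [≡μ] *)

Section saturation.
Context {R : realType} d (S : measurableType d).

(** The saturated sets form a sigma-algebra that contains the generators, since
a generator constrains the value of the measure at one measurable set. *)
Lemma measurable_finite_measures_sat (B : set (finite_measures S R))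
    (mu nu : finite_measures S R) :
  measurable B -> mu ≡μ nu -> B mu <-> B nu.
Proof.
move=> mB; move: mu nu; pose sat := [set C : set (finite_measures S R) |
  forall mu nu : finite_measures S R, mu ≡μ nu -> C mu <-> C nu].
suff : @finite_measures_generators _ S R `<=` sat.
  move=> Gsat; move: B mB; change (<<s @finite_measures_generators _ S R >> `<=` sat).
  apply: smallest_sub => //; split => //=.
  - by move=> C satC mu nu /satC munu; split => -[_ nC]; split => // /munu.
  - move=> F satF mu nu munu; split => -[n _ Fn]; exists n => //.
      exact/(satF n mu nu munu).
    exact/(satF n mu nu munu).
by move=> _ [A mA [C mC <-]] mu nu munu; rewrite !setTI /preimage/= munu.
Qed.

Lemma measurable_nonzero_measures_sat (B : set (nonzero_measures S R))
    (mu nu : nonzero_measures S R) :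
  measurable B -> nm_val mu ≡μ nm_val nu -> B mu <-> B nu.
Proof.
move=> [C mC <-] munu; rewrite setTI.
exact: (measurable_finite_measures_sat mC munu).
Qed.

End saturation.

(** * Realizing a kernel with one uniform variable *)

Section randomization.
Context {R : realType} d (S : measurableType d) d' (X : measurableType d').

(** [F (x, u)] decodes the [u]-quantile of the law of the code under [K x]. *)
Lemma kernel_randomization (K : R.-pker X ~> finite_measures S R) :
  borel_space R S ->
  exists2 F : X * unit_itv R -> finite_measures S R, measurable_fun setT F &
    forall x B, measurable B -> lebesgue01 [set u | B (F (x, u))] = K x B.
Proof.
move=> /finite_measures_retract[e [D [me mD e01 DeK]]].
pose eF : {mfun finite_measures S R >-> R} :=
  HB.pack e (isMeasurableFun.Build _ _ _ _ e me).
pose c x n := K x (eF @^-1` `]-oo, grid n]%classic).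
exists (fun p => D (quantile (c p.1) (unit_itv_val p.2))).
  apply: (measurableT_comp mD); apply: measurable_quantile => [n|].
    apply: (measurableT_comp (measurable_kernel K _ _)) => //.
    exact: measurable_preimageT.
  have mval : measurable_fun setT (@unit_itv_val R) by move=> _ B mB; exists B.
  exact: (measurableT_comp mval).
move=> x B mB.
have Kfin : fin_num_fun (K x).
  by apply: lty_fin_num_fun; rewrite prob_kernel ltry.
pose nu := fm_image (fm_of Kfin) eF.
have nu01 : nu (~` `[0%R, 1%R]) = 0.
  rewrite fm_imageE (_ : _ @^-1` _ = set0) ?measure0//; apply/seteqP; split => // mu.
  by apply; rewrite /= in_itv/=; exact: e01.
have mDB : measurable (D @^-1` B) by exact: measurable_preimageT.
have nuE := quantile_law nu01 mDB.
have nuT : fine (nu setT) = 1%R by rewrite fm_imageE [fm_of _ _]prob_kernel.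
have -> : K x B = nu (D @^-1` B).
  rewrite fm_imageE; apply: (congr1 (K x)); apply/seteqP; split => mu /=.
    by move/(measurable_finite_measures_sat mB (DeK mu)).
  by move/(measurable_finite_measures_sat mB (DeK mu)).
rewrite -nuE nuT /lebesgue01; congr lebesgue_measure.
apply/seteqP; split => [_ [u Bu <-]|t [t01 Bt]].
  split => //; have := set_valP u; by rewrite /I01_set/= in_itv.
have It : I01_set t by rewrite /I01_set /= in_itv.
by exists (SigSub (mem_set It)).
Qed.

End randomization.
(** * From an urn in S to an urn in S * [0,1] *)

Section product_with_lebesgue.
Context {R : realType} d (S : measurableType d).
Local Notation I := (unit_itv R).
Local Notation lam := (@lebesgue01 R).

Section fm_prod.
Variable mu : finite_measures S R.

Definition fm_prod_fun : set (S * I) -> \bar R := (mu \x lam)%E.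

HB.instance Definition _ := Measure.on fm_prod_fun.

Lemma fm_prod_setT : fm_prod_fun setT = mu setT.
Proof.
by rewrite /fm_prod_fun -setXTT product_measure1E// [X in _ * X]probability_setT mule1.
Qed.

Let fm_prod_fin : fin_num_fun fm_prod_fun.
Proof.
apply: lty_fin_num_fun.
by rewrite [X in X < _]fm_prod_setT ltey_eq fin_num_measure.
Qed.

HB.instance Definition _ := Measure_isFinite.Build _ _ _ fm_prod_fun fm_prod_fin.

Definition fm_prod : finite_measures (S * I)%type R := fm_prod_fun.

End fm_prod.

Lemma measurable_lebesgue01_xsection (A : set (S * I)) : measurable A ->
  measurable_fun setT (fun s => lam (xsection A s)).
Proof. by move=> mA; exact: (measurable_fun_xsection lam). Qed.

Lemma measurable_fm_prod : measurable_fun setT fm_prod.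
Proof.
apply: measurable_to_finite_measures => A mA.
apply: (@measurable_fun_integral_kernel _ _ _ _ _
  (fun mu : finite_measures S R => mu : {measure set S -> \bar R})) => //.
- by move=> U mU; exact: measurable_fm_eval.
- exact: measurable_lebesgue01_xsection.
Qed.

Lemma eq_fm_prod (mu nu : finite_measures S R) :
  mu ≡μ nu -> fm_prod mu ≡μ fm_prod nu.
Proof.
move=> munu A mA; apply: (@eq_measure_integral _ _ _ _ nu mu) => B mB _.
exact: munu.
Qed.

(** Additivity of the product in its first factor is what makes an update in
[S] correspond to an update in [S * [0,1]]. *)
Lemma fm_prod_add (mu nu : finite_measures S R) :
  fm_prod (fm_add mu nu) ≡μ fm_add (fm_prod mu) (fm_prod nu).
Proof.
move=> A mA; rewrite [RHS]fm_addE.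
apply: (@ge0_integral_measure_add _ _ _ mu nu) => //.
exact: measurable_lebesgue01_xsection.
Qed.

Lemma nonzero_fm_prod (mu : nonzero_measures S R) : nonzero (fm_prod mu).
Proof.
apply/nonzeroP; rewrite [X in _ < X]fm_prod_setT.
by apply/nonzeroP; exact: set_valP.
Qed.

Definition nm_prod (mu : nonzero_measures S R) : nonzero_measures (S * I)%type R :=
  SigSub (mem_set (@nonzero_fm_prod mu)).

Lemma measurable_nm_prod : measurable_fun setT nm_prod.
Proof.
apply: measurable_to_nonzero_measures.
exact: (measurableT_comp measurable_fm_prod (@measurable_nm_val _ S R)).
Qed.

Let fstF : {mfun (S * I)%type >-> S} :=
  HB.pack (@fst S I) (isMeasurableFun.Build _ _ _ _ (@fst S I) measurable_fst).

Lemma nonzero_fm_image_fst (mu : nonzero_measures (S * I)%type R) :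
  nonzero (fm_image mu fstF).
Proof.
apply/nonzeroP; rewrite fm_imageE preimage_setT.
by apply/nonzeroP; exact: set_valP.
Qed.

Definition nm_proj (mu : nonzero_measures (S * I)%type R) : nonzero_measures S R :=
  SigSub (mem_set (@nonzero_fm_image_fst mu)).

Lemma measurable_nm_proj : measurable_fun setT nm_proj.
Proof.
apply: measurable_to_nonzero_measures; apply: measurable_to_finite_measures => A mA.
apply: (measurableT_comp (measurable_fm_eval _) (@measurable_nm_val _ _ R)).
exact: (measurable_preimageT measurable_fst).
Qed.

Lemma fm_prod_fst (mu : finite_measures S R) B : measurable B ->
  fm_prod mu (fst @^-1` B) = mu B.
Proof.
move=> mB; rewrite -setXT [LHS]product_measure1E//.
by rewrite [X in _ * X]probability_setT mule1.
Qed.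

(** The marginal recovers [mu]: passing to the product loses no information. *)
Lemma nm_prodK (mu : nonzero_measures S R) :
  nm_val (nm_proj (nm_prod mu)) ≡μ nm_val mu.
Proof. by move=> B mB; exact: fm_prod_fst. Qed.

Lemma integral_nm_normalize (mu : nonzero_measures S R) (h : S -> \bar R) :
  (forall s, 0 <= h s) -> measurable_fun setT h ->
  \int[nm_normalize mu]_s h s = \int[mu]_s h s * (fine (mu setT))^-1%:E.
Proof.
move=> h0 mh.
have c0 : (0 <= (fine (mu setT))^-1)%R by rewrite invr_ge0 fine_ge0.
rewrite (eq_measure_integral (mscale (NngNum c0) mu)); last first.
  by move=> A mA _; apply: etrans (nm_normalizeE mu A) _; rewrite muleC.
by rewrite ge0_integral_mscale//= muleC.
Qed.

(** The factor [lambda] has total mass 1, so normalizing [mu \x lambda] gives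
[mu' \x lambda]: the second coordinate of the drawn colour is uniform and
independent of the first. *)
Lemma nm_normalize_prod (mu : nonzero_measures S R) C : measurable C ->
  nm_normalize (nm_prod mu) C = \int[nm_normalize mu]_s lam (xsection C s).
Proof.
move=> mC; rewrite integral_nm_normalize//; last exact: measurable_lebesgue01_xsection.
by rewrite nm_normalizeE [X in fine X]fm_prod_setT.
Qed.

Section urn_kernels.
Variables (K : R.-pker S ~> finite_measures S R) (F : S * I -> finite_measures S R).
Hypothesis mF : measurable_fun setT F.
Hypothesis FK : forall s B, measurable B -> lam [set u | B (F (s, u))] = K s B.
Variable Rk : {mfun (S * I)%type >-> finite_measures (S * I)%type R}.
Hypothesis RkE : forall p, Rk p = fm_prod (F p).

(** Given the first coordinate [s] of the drawn colour, the second one is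
uniform, so the measure [F (s, u)] that is added to [mu] has law [K s], as in
the urn with random replacements. *)
Lemma det_urn_kernel_prod (mu : nonzero_measures S R) B : measurable B ->
  det_urn_kernel Rk (nm_prod mu) B = rand_urn_kernel K mu (nm_prod @^-1` B).
Proof.
move=> mB.
have mBp : measurable (nm_prod @^-1` B) := measurable_preimageT measurable_nm_prod mB.
have madd : measurable_fun setT (nm_add mu).
  exact: (measurableT_comp (@measurable_nm_add _ S R) (pair1_measurable mu)).
pose C := [set p | B (nm_prod (nm_add mu (F p)))].
have mC : measurable C.
  exact: (measurable_preimageT (measurableT_comp madd mF) mBp).
have updateE p : B (det_update Rk (nm_prod mu) p) <-> C p.
  apply: (measurable_nonzero_measures_sat mB) => A mA.
  by apply: etrans (esym (fm_prod_add mu (F p) mA)); rewrite /= RkE.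
have -> : det_urn_kernel Rk (nm_prod mu) B = nm_normalize (nm_prod mu) C.
  rewrite /det_urn_kernel /distribution /pushforward /=; congr (mnormalize _ _ _).
  by apply/seteqP; split => p /updateE.
rewrite nm_normalize_prod//; apply: eq_integral => s _.
have mBs : measurable (nm_add mu @^-1` (nm_prod @^-1` B)) by exact: measurable_preimageT.
apply: etrans (FK s mBs); congr (lam _).
by apply/seteqP; split => u; rewrite /xsection /= inE.
Qed.

End urn_kernels.
End product_with_lebesgue.
(** * Images of Markov chains *)

Section markov_chain_image.
Context {R : realType} d (Omega : measurableType d) (P : probability Omega R).
Context d1 d2 (E1 : measurableType d1) (E2 : measurableType d2).
Variables (K1 : R.-pker E1 ~> E1) (K2 : R.-pker E2 ~> E2).
Variables (Phi : E1 -> E2) (Psi : E2 -> E1).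
Hypotheses (mPhi : measurable_fun setT Phi) (mPsi : measurable_fun setT Psi).
Hypothesis PhiK : forall C, measurable C -> Phi @^-1` (Psi @^-1` C) = C.
Hypothesis K21 : forall x B, measurable B -> K2 (Phi x) B = K1 x (Phi @^-1` B).

(** A function of a Markov chain need not be Markov, as its past may carry less
information.  Here [Phi] has an inverse [Psi] as far as measurable sets can
tell, so [X] and its image generate the same past, and a conditional
probability for the first chain serves for the second. *)
Lemma markov_chain_image (X : nat -> {RV P >-> E1}) (Y : nat -> {RV P >-> E2}) :
  (forall n w, Y n w = Phi (X n w)) -> markov_chain K1 X -> markov_chain K2 Y.
Proof.
move=> YE markovX n B mB.
have mPB : measurable (Phi @^-1` B) by exact: measurable_preimageT.
have [Z Zcond ZE] := markovX n _ mPB.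
have same_past : g_sigma_preimage (fun i : 'I_n.+1 => Y i : Omega -> E2) =
                 g_sigma_preimage (fun i : 'I_n.+1 => X i : Omega -> E1).
  congr (<<s _ >>); apply: eq_bigr => i _; apply/seteqP; split => _ [C mC <-].
    exists (Phi @^-1` C); first exact: measurable_preimageT.
    by apply/seteqP; split => w /=; rewrite YE.
  exists (Psi @^-1` C); first exact: measurable_preimageT.
  by rewrite -[in RHS](PhiK mC); apply/seteqP; split => w /=; rewrite YE.
exists Z; last by apply: filterS ZE => w ->; rewrite YE K21.
rewrite same_past (_ : Y n.+1 @^-1` B = X n.+1 @^-1` (Phi @^-1` B))//.
by apply/seteqP; split => w /=; rewrite YE.
Qed.

End markov_chain_image.

Unset Implicit Arguments.

Theorem theorem1p3 (R : realType) (d d' : measure_display)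
    (S : measurableType d) (Omega : measurableType d')
    (P : probability Omega R)
    (X : nat -> {RV P >-> nonzero_measures S R}) :
  borel_space R S ->
  polya_urn_random X ->
  exists Xt : nat -> {RV P >-> nonzero_measures (S * unit_itv R)%type R},
    polya_urn_deterministic Xt /\
    forall (n : nat) (w : Omega),
      nm_val (Xt n w) ≡μ (nm_val (X n w) \x @lebesgue01 R) /\
      forall B : set S, measurable B ->
        nm_val (X n w) B = pushforward (nm_val (Xt n w)) fst B.
Proof.
move=> borelS [[mu0 X0] [K markovX]].
have [F mF FK] := kernel_randomization K borelS.
have mXt n : measurable_fun setT (@nm_prod R d S \o X n).
  by apply: measurableT_comp => //; exact: measurable_nm_prod.
pose Xt n : {RV P >-> nonzero_measures (S * unit_itv R)%type R} :=
  HB.pack (@nm_prod R d S \o X n) (isMeasurableFun.Build _ _ _ _ _ (mXt n)).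
have mRk := measurableT_comp (@measurable_fm_prod R d S) mF.
pose Rk : {mfun (S * unit_itv R)%type >-> finite_measures (S * unit_itv R)%type R} :=
  HB.pack (@fm_prod R d S \o F) (isMeasurableFun.Build _ _ _ _ _ mRk).
exists Xt; split; last first.
  move=> n w; split => // B mB; exact: (esym (fm_prod_fst _ mB)).
split; first by exists (nm_prod mu0) => w; apply: eq_fm_prod.
exists Rk; apply: (markov_chain_image _ _ _ _ _ markovX) => //.
- exact: measurable_nm_prod.
- exact: measurable_nm_proj.
- move=> C mC; apply/seteqP; split => mu.
    by move/(measurable_nonzero_measures_sat mC (nm_prodK mu)).
  by move/(measurable_nonzero_measures_sat mC (nm_prodK mu)).
- by move=> mu B mB; exact: (det_urn_kernel_prod mF FK).
Qed.
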